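(* Let $(\bar A,\bar B)$ be a structured system with $n$ states and $m$ inputs, let $q$ be the number of non-top linked SCC's of the state digraph $D(\bar A)$, and let $f^\star$ be a maximum flow vector (a feasible flow vector maximizing the flow from $s$ to $t$) in the flow network $F(\bar A,\bar B)$. Then $(\bar A,\bar B)$ is structurally controllable if and only if the maximum flow satisfies $\varphi_{f^\star}\ge q+n$.
   Context: Structured systems. A structured system is a pair $(\bar A,\bar B)$ with $\bar A\in\{0,\star\}^{n\times n}$, $\bar B\in\{0,\star\}^{n\times m}$. A numerical realization is a pair of real matrices $(A,B)$ of the same sizes with $A_{ij}=0$ whenever $\bar A_{ij}=0$ and $B_{ij}=0$ whenever $\bar B_{ij}=0$. $(\bar A,\bar B)$ is structurally controllable if some numerical realization $(A,B)$ is controllable, i.e. $\mathrm{rank}[B\ AB\ \cdots\ A^{n-1}B]=n$. State digraph and SCC's. $D(\bar A)$ has vertices $x_1,\dots,x_n$ and a directed edge $(x_j,x_i)$ iff $\bar A_{ij}\ne 0$. SCC means (maximal) strongly connected component; an SCC is non-top linked if it has no incoming edges to its vertices from vertices of another SCC. Let $\mathcal N_1,\dots,\mathcal N_q$ be the non-top linked SCC's of $D(\bar A)$. Flow network $F(\bar A,\bar B)$. Vertex set $V_F=\{s,t\}\cup\{\mathcal N_i\}_{i=1}^q\cup\{x'_k\}_{k=1}^n\cup\{x_r\}_{r=1}^n\cup\{u_j\}_{j=1}^m\cup\{u'_j\}_{j=1}^m$ with source $s$ and sink $t$. Directed edge set $E_F$: $(s,\mathcal N_i)$ for all $i$; $(s,x'_k)$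 for all $k$; $(\mathcal N_i,u'_j)$ whenever $\bar B_{rj}=\star$ for some $x_r\in\mathcal N_i$; $(x'_k,x_r)$ whenever $\bar A_{kr}\neq0$; $(x'_k,u_j)$ whenever $\bar B_{kj}\ne0$; $(u_j,u'_j)$ for all $j$; $(u'_j,t)$ for all $j$; $(x_r,t)$ for all $r$. Capacities: $b((u'_j,t))=n+1$ for all $j$, and $b(e)=1$ for every other edge. Flows. A flow vector is a function $f:E_F\to\mathbb R_{\ge0}$. It is feasible if $f(e)\le b(e)$ for all $e$ and, at every vertex other than $s,t$, total outgoing flow equals total incoming flow. The flow from source to sink is $\varphi_f=\sum_{e=(s,v)\in E_F}f(e)$. *)

(* Defs.v *)
(* The real numbers are an arbitrary [R : realType]. *)
From HB Require Import structures.
From mathcomp Require Import all_boot all_order all_algebra.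
From mathcomp Require Import reals.

Set Implicit Arguments.
Unset Strict Implicit.
Unset Printing Implicit Defensive.

Import Order.TTheory GRing.Theory Num.Theory.
Local Open Scope ring_scope.

(* A pattern in {0, *}^(p x q) is a boolean matrix: [true] is a star (free
   entry), [false] is a fixed zero. *)
Definition realizes (R : realType) (p q : nat) (Mbar : 'M[bool]_(p, q))
    (M : 'M[R]_(p, q)) : Prop :=
  forall i j, Mbar i j = false -> M i j = 0.

Definition controllability_mx (R : realType) (n m : nat)
    (A : 'M[R]_n) (B : 'M[R]_(n, m)) :=
  \mxrow_(k < n) (A ^+ k *m B).

Definition controllable (R : realType) (n m : nat)
    (A : 'M[R]_n) (B : 'M[R]_(n, m)) : Prop :=
  \rank (controllability_mx A B) = n.

Definition structurally_controllable (R : realType) (n m : nat)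
    (Abar : 'M[bool]_n) (Bbar : 'M[bool]_(n, m)) : Prop :=
  exists (A : 'M[R]_n) (B : 'M[R]_(n, m)),
    [/\ realizes Abar A, realizes Bbar B & controllable A B].

(* Note the transposition: [state_edge Abar j i] is the edge (x_j, x_i). *)
Definition state_edge (n : nat) (Abar : 'M[bool]_n) : rel 'I_n :=
  [rel j i | Abar i j].

(* Paths are required to stay inside S, i.e. the induced subgraph on S is
   strongly connected.  Without the nonemptiness condition, set0 would be
   an SCC of the empty digraph. *)
Definition strongly_connected (n : nat) (Abar : 'M[bool]_n)
    (S : {set 'I_n}) : bool :=
  (S != set0) &&
  [forall x in S, forall y in S,
     connect [rel u v | [&& u \in S, v \in S & state_edge Abar u v]] x y].

Definition is_scc (n : nat) (Abar : 'M[bool]_n) (S : {set 'I_n}) : bool :=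
  maxset (strongly_connected Abar) S.

Definition non_top_linked (n : nat) (Abar : 'M[bool]_n)
    (S : {set 'I_n}) : bool :=
  [forall S' : {set 'I_n}, is_scc Abar S' && (S' != S) ==>
     [forall y in S', forall x in S, ~~ state_edge Abar y x]].

Definition ntl_sccs (n : nat) (Abar : 'M[bool]_n) : {set {set 'I_n}} :=
  [set S | is_scc Abar S && non_top_linked Abar S].

Definition num_ntl_sccs (n : nat) (Abar : 'M[bool]_n) : nat :=
  #|ntl_sccs Abar|.

Inductive net_vertex (n m : nat) (Abar : 'M[bool]_n) : Type :=
  | Vs
  | Vt
  | VN of {S : {set 'I_n} | S \in ntl_sccs Abar}
  | Vx' of 'I_n
  | Vx of 'I_n
  | Vu of 'I_m
  | Vu' of 'I_m.

Arguments Vs {n m Abar}.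
Arguments Vt {n m Abar}.
Arguments VN {n m Abar}.
Arguments Vx' {n m Abar}.
Arguments Vx {n m Abar}.
Arguments Vu {n m Abar}.
Arguments Vu' {n m Abar}.

(* The next definitions only serve to make [net_vertex] a finType. *)
Definition net_vertex_code (n m : nat) (Abar : 'M[bool]_n) : Type :=
  (bool + {S : {set 'I_n} | S \in ntl_sccs Abar}
   + ('I_n + 'I_n) + ('I_m + 'I_m))%type.

Definition net_vertex_encode (n m : nat) (Abar : 'M[bool]_n)
    (v : net_vertex m Abar) : net_vertex_code m Abar :=
  match v with
  | Vs => inl (inl (inl true))
  | Vt => inl (inl (inl false))
  | VN C => inl (inl (inr C))
  | Vx' k => inl (inr (inl k))
  | Vx r => inl (inr (inr r))
  | Vu j => inr (inl j)
  | Vu' j => inr (inr j)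
  end.

Definition net_vertex_decode (n m : nat) (Abar : 'M[bool]_n)
    (c : net_vertex_code m Abar) : net_vertex m Abar :=
  match c with
  | inl (inl (inl true)) => Vs
  | inl (inl (inl false)) => Vt
  | inl (inl (inr C)) => VN C
  | inl (inr (inl k)) => Vx' k
  | inl (inr (inr r)) => Vx r
  | inr (inl j) => Vu j
  | inr (inr j) => Vu' j
  end.

Lemma net_vertex_encodeK (n m : nat) (Abar : 'M[bool]_n) :
  cancel (@net_vertex_encode n m Abar) (@net_vertex_decode n m Abar).
Proof. by case. Qed.

HB.instance Definition _ (n m : nat) (Abar : 'M[bool]_n) :=
  Finite.copy (net_vertex m Abar) (can_type (@net_vertex_encodeK n m Abar)).

Definition net_adj (n m : nat) (Abar : 'M[bool]_n) (Bbar : 'M[bool]_(n, m))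
    (v w : net_vertex m Abar) : bool :=
  match v, w with
  | Vs, VN _ => true
  | Vs, Vx' _ => true
  | VN C, Vu' j => [exists r in val C, Bbar r j]
  | Vx' k, Vx r => Abar k r
  | Vx' k, Vu j => Bbar k j
  | Vu i, Vu' j => i == j
  | Vu' _, Vt => true
  | Vx _, Vt => true
  | _, _ => false
  end.

Definition net_edge (n m : nat) (Abar : 'M[bool]_n) (Bbar : 'M[bool]_(n, m)) :=
  {e : net_vertex m Abar * net_vertex m Abar | net_adj Bbar e.1 e.2}.

Definition capacity (R : realType) (n m : nat) (Abar : 'M[bool]_n)
    (Bbar : 'M[bool]_(n, m)) (e : net_edge Abar Bbar) : R :=
  match val e with
  | (Vu' _, Vt) => n.+1%:R
  | _ => 1
  end.

Definition outflow (R : realType) (n m : nat) (Abar : 'M[bool]_n)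
    (Bbar : 'M[bool]_(n, m)) (f : net_edge Abar Bbar -> R)
    (v : net_vertex m Abar) : R :=
  \sum_(e : net_edge Abar Bbar | (val e).1 == v) f e.

Definition inflow (R : realType) (n m : nat) (Abar : 'M[bool]_n)
    (Bbar : 'M[bool]_(n, m)) (f : net_edge Abar Bbar -> R)
    (v : net_vertex m Abar) : R :=
  \sum_(e : net_edge Abar Bbar | (val e).2 == v) f e.

Definition feasible_flow (R : realType) (n m : nat) (Abar : 'M[bool]_n)
    (Bbar : 'M[bool]_(n, m)) (f : net_edge Abar Bbar -> R) : Prop :=
  [/\ forall e, 0 <= f e,
      forall e, f e <= capacity R e
    & forall v, v != Vs -> v != Vt -> outflow f v = inflow f v].

Definition flow_value (R : realType) (n m : nat) (Abar : 'M[bool]_n)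
    (Bbar : 'M[bool]_(n, m)) (f : net_edge Abar Bbar -> R) : R :=
  outflow f Vs.

Definition maximum_flow (R : realType) (n m : nat) (Abar : 'M[bool]_n)
    (Bbar : 'M[bool]_(n, m)) (f : net_edge Abar Bbar -> R) : Prop :=
  feasible_flow f /\
  forall g : net_edge Abar Bbar -> R,
    feasible_flow g -> flow_value g <= flow_value f.

(* Main.v *)
Require Import Defs.
From mathcomp Require Import all_boot all_order all_algebra all_fingroup.
From mathcomp Require Import boolp reals zify lra.

(** Every edge leaving the source has capacity 1 and there are [q + n] of them,
    so a flow of value [q + n] saturates them all.  The unit that enters a
    non-top linked component must leave it towards some input, so every such
    component is acted upon by an input ([accessible]).  The unit that enters
    [x'_k] is spread over the stars of row [k] of [[Abar Bbar]], while no column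
    carries more than one unit: this fractional matching gives Hall's condition
    for matching the rows into the columns ([hall_of_flow]).  Conversely, an
    input for each component and a matching can be put together into a flow of
    value [q + n] ([flow_of_matching]); the capacity [n + 1] of the last edges
    suffices because [q <= n].

    There remains Lin's theorem: structural controllability amounts to
    accessibility together with such a matching.  Necessity is direct.  A row
    vector supported on a non-top linked component without inputs is never seen
    by [B] ([controllable_accessible]), and when [[A B]] has full row rank some
    maximal minor has a nonzero term in its Leibniz expansion, which is a
    matching ([controllable_matching]).

    For sufficiency, inputs are treated as vertices alongside the states.  A
    matching becomes a permutation [s] of all vertices with an edge from [s x] to
    [x] for every state [x]; its orbits through inputs are cut by the inputs into
    disjoint chains starting at inputs, and its other orbits are cycles of
    states.  The chains alone, with unit weights, reach all of their vertices
    ([stems_reachable]).  Accessibility then provides an edge [p -> c] from the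
    part already reached into a new cycle, which is added with all its edges
    weighted by the same number [lam] ([add_cycle_reachable]).  Let [A] be the
    old weight matrix, [A'] the new one, [u] an input from which [p] is reached,
    and [chi] a multiple of the characteristic polynomial of [A].  Since [A' - A]
    acts on the old part only through [p -> c], one gets
    [chi(A') e_u = g(A') e_c] for a nonzero polynomial [g] which depends on [A]
    but not on [lam] ([horner_transfer], [markov_num_neq0]).  Going once around
    the cycle, of length [l], gives [(A' ^ l - lam ^ l) e_c = 0].  For a suitable
    [lam] the polynomials [g] and ['X^l - lam ^ l] are coprime
    ([coprime_power_shift]), and a Bezout relation puts [e_c] in the space
    reached from [u]; the rest of the cycle and the old part follow. *)

Set Implicit Arguments.
Unset Strict Implicit.
Unset Printing Implicit Defensive.

Import Order.TTheory GRing.Theory Num.Theory.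
Local Open Scope ring_scope.

(** * Hall's marriage theorem *)

Definition hall_nbrs (T T' : finType) (r : {set T * T'}) (S : {set T}) : {set T'} :=
  [set y | [exists x in S, (x, y) \in r]].

Definition hall_cond (T T' : finType) (r : {set T * T'}) : bool :=
  [forall S : {set T}, #|S| <= #|hall_nbrs r S|]%N.

Lemma hall_nbrsP (T T' : finType) (r : {set T * T'}) (S : {set T}) y :
  reflect (exists2 x, x \in S & (x, y) \in r) (y \in hall_nbrs r S).
Proof.
rewrite inE; apply: (iffP existsP) => [[x /andP[]]|[x xS xy]]; first by exists x.
by exists x; rewrite xS.
Qed.

(** Rado's argument: in a minimal relation that still satisfies Hall's condition
    every [x] has a single partner.  Indeed, if both [(x, y1)] and [(x, y2)] could
    not be deleted, two sets witnessing this would, by counting neighbours of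
    their union and of their intersection without [x], contradict the condition. *)
Lemma hall (T T' : finType) (r : {set T * T'}) :
  hall_cond r -> exists2 f : T -> T', injective f & forall x, (x, f x) \in r.
Proof.
case/minset_exists=> r0 /minsetP[/forallP hr0 minr0] sub.
have nb1 x : (0 < #|hall_nbrs r0 [set x]|)%N.
  by apply: leq_trans (hr0 [set x]); rewrite cards1.
have ex x : exists y, (x, y) \in r0.
  have /card_gt0P[y /hall_nbrsP[x' /set1P -> xy]] := nb1 x.
  by exists y.
have fP x : exists y, (x, y) \in r0 /\ forall y', (x, y') \in r0 -> y' = y.
  have [y1 xy1] := ex x; exists y1; split=> // y2 xy2; apply/eqP/negPn/negP => ny.
  have bad y : (x, y) \in r0 -> exists S : {set T},
      [/\ x \in S & (#|hall_nbrs (r0 :\ (x, y)) S| < #|S|)%N].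
    move=> xy; have : ~~ hall_cond (r0 :\ (x, y)).
      apply/negP=> h; have := minr0 _ h (subsetDl _ _).
      by move/setP/(_ (x, y)); rewrite !inE eqxx xy.
    rewrite negb_forall => /existsP[S]; rewrite -ltnNge => ltS; exists S; split=> //.
    apply/negPn/negP=> xS; move: ltS; rewrite ltnNge => /negP; apply.
    apply: leq_trans (hr0 S) (subset_leq_card _); apply/subsetP=> w /hall_nbrsP[t tS tw].
    apply/hall_nbrsP; exists t => //; rewrite !inE tw andbT.
    by apply: contraNneq xS => -[<- _].
  have [S1 [xS1 lt1]] := bad _ xy1; have [S2 [xS2 lt2]] := bad _ xy2.
  set N1 := hall_nbrs _ _ in lt1; set N2 := hall_nbrs _ _ in lt2.
  (* A neighbour of [x] other than [y1] survives in [N1], and [y1] survives in [N2]. *)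
  have subU : hall_nbrs r0 (S1 :|: S2) \subset N1 :|: N2.
    apply/subsetP=> w /hall_nbrsP[t]; rewrite !in_setU => tS tw.
    case: (eqVneq t x) => [tx|tx].
      case: (eqVneq w y1) => [wy|wy].
        apply/orP; right; apply/hall_nbrsP; exists t; rewrite ?tx // !inE -tx tw andbT.
        by rewrite wy; apply: contraNneq ny => -[->].
      apply/orP; left; apply/hall_nbrsP; exists t; rewrite ?tx // !inE -tx tw andbT.
      by apply: contraNneq wy => -[->].
    case/orP: tS => tS; apply/orP; [left|right]; apply/hall_nbrsP; exists t => //;
      by rewrite !inE tw andbT; apply: contraNneq tx => -[->].
  have subI : hall_nbrs r0 ((S1 :&: S2) :\ x) \subset N1 :&: N2.
    apply/subsetP=> w /hall_nbrsP[t]; case/setD1P=> tx /setIP[t1 t2] tw.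
    apply/setIP; split; apply/hall_nbrsP; exists t => //;
      by rewrite !inE tw andbT; apply: contraNneq tx => -[->].
  have := leq_trans (hr0 _) (subset_leq_card subU).
  have := leq_trans (hr0 _) (subset_leq_card subI).
  have := cardsD1 x (S1 :&: S2); rewrite inE xS1 xS2 /=.
  have := cardsUI S1 S2; have := cardsUI N1 N2.
  by move: lt1 lt2; clear; lia.
pose f x := xchoose (ex x).
have fr x : (x, f x) \in r0 by have := xchooseP (ex x).
have funi x y : (x, y) \in r0 -> y = f x.
  by move=> xy; have [z [_ hz]] := fP x; rewrite (hz _ xy) (hz _ (fr x)).
exists f => [x1 x2 fx|x]; last by apply: (subsetP sub).
apply/eqP/negPn/negP => nx.
have := hr0 [set x1; x2]; rewrite cards2 nx leqNgt => /negP; apply.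
apply: (@leq_ltn_trans #|[set f x1]|); last by rewrite cards1.
apply: subset_leq_card; apply/subsetP=> w.
by case/hall_nbrsP=> t /set2P[] -> /funi ->; rewrite inE // fx.
Qed.


(** * Non-top linked components *)

Section Components.
Variables (n : nat) (Abar : 'M[bool]_n).
Implicit Types (S N : {set 'I_n}).

Definition pred_closed N := forall y x, x \in N -> state_edge Abar y x -> y \in N.

Lemma connect_pred_closed N y x :
  pred_closed N -> connect (state_edge Abar) y x -> x \in N -> y \in N.
Proof.
move=> pN /connectP[p + ->]; elim: p y => //= z p IH y /andP[yz /IH h] /h zN.
exact: pN zN yz.
Qed.

Lemma strongly_connectedW S x y :
  strongly_connected Abar S -> x \in S -> y \in S -> connect (state_edge Abar) x y.
Proof.
case/andP=> _ /forall_inP/(_ x) H xS yS; have /forall_inP/(_ y yS) := H xS.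
by apply: connect_sub => u v /and3P[_ _ uv]; apply: connect1.
Qed.

(** Everything that leads into a predecessor-closed set lies in it, so a strongly
    connected set is contained in such a set as soon as it meets it. *)
Lemma strongly_connected_sub S N x :
  strongly_connected Abar S -> pred_closed N -> x \in S -> x \in N -> S \subset N.
Proof.
move=> sS pN xS xN; apply/subsetP=> y yS.
exact: connect_pred_closed (strongly_connectedW sS yS xS) xN.
Qed.

(** [non_top_linked] only speaks of edges from other components; it suffices that
    each vertex [y] lies in one, namely any maximal strongly connected set
    containing the singleton of [y]. *)
Lemma ntl_pred_closed N : N \in ntl_sccs Abar -> pred_closed N.
Proof.
rewrite inE => /andP[_ /forallP ntl] y x xN yx; apply/negPn/negP=> yN.
have s1 : strongly_connected Abar [set y].
  rewrite /strongly_connected -cards_eq0 cards1 /=.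
  apply/forall_inP=> a /set1P ->; apply/forall_inP=> b /set1P ->; exact: connect0.
have [S' mS' /subsetP/(_ y)] := maxset_exists s1; rewrite inE eqxx => /(_ isT) yS'.
have nSN : S' != N by apply: contraNneq yN => <-.
have /implyP := ntl S'; rewrite /is_scc mS' nSN => /(_ isT).
by move=> /forall_inP/(_ y yS')/forall_inP/(_ x xN); rewrite yx.
Qed.

Lemma ntl_strongly_connected N : N \in ntl_sccs Abar -> strongly_connected Abar N.
Proof. by rewrite inE => /andP[/maxsetP[]]. Qed.

Lemma ntl_neq0 N : N \in ntl_sccs Abar -> exists x, x \in N.
Proof. by move/ntl_strongly_connected=> /andP[/set0Pn]. Qed.

(** Non-top linked components are nonempty and pairwise disjoint. *)
Lemma num_ntl_le : (num_ntl_sccs Abar <= n)%N.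
Proof.
have tr : trivIset (ntl_sccs Abar).
  apply/trivIsetP=> N1 N2 h1 h2; apply: contraNT => /pred0Pn[x /andP[/= x1 x2]].
  rewrite eqEsubset; apply/andP; split.
    exact: strongly_connected_sub (ntl_strongly_connected h1) (ntl_pred_closed h2) x1 x2.
  exact: strongly_connected_sub (ntl_strongly_connected h2) (ntl_pred_closed h1) x2 x1.
have := max_card (cover (ntl_sccs Abar)); rewrite card_ord -(eqP tr); apply: leq_trans.
rewrite /num_ntl_sccs -sum1_card; apply: leq_sum => N /ntl_neq0 [x xN].
by apply/card_gt0P; exists x.
Qed.

(** The component is the set of predecessors of a vertex [x] of [Q] that has as few
    predecessors as possible: a predecessor [y] of [x] then has the same ones, so
    that [x] leads back to [y]. *)
Lemma ntl_in_pred_closed Q : Q != set0 -> pred_closed Q ->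
  exists2 N, N \in ntl_sccs Abar & N \subset Q.
Proof.
case/set0Pn=> x0 x0Q pQ.
pose P x := [set y | connect (state_edge Abar) y x].
have PQ x : x \in Q -> P x \subset Q.
  by move=> xQ; apply/subsetP=> y; rewrite inE => yx; apply: connect_pred_closed yx xQ.
case: (arg_minnP (fun x => #|P x|) x0Q) => x xQ xmin.
have pP : pred_closed (P x).
  by move=> a b; rewrite !inE => bx ab; apply: connect_trans (connect1 ab) bx.
have Pback y : y \in P x -> connect (state_edge Abar) x y.
  move=> yP; have yQ := subsetP (PQ x xQ) y yP.
  have sPP : P y \subset P x.
    apply/subsetP=> z; rewrite !inE in yP * => zy; exact: connect_trans zy yP.
  have /eqP E : P y == P x by rewrite eqEcard sPP xmin.
  by have : x \in P x; [rewrite inE connect0 | rewrite -E inE].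
have sP : strongly_connected Abar (P x).
  apply/andP; split; first by apply/set0Pn; exists x; rewrite inE connect0.
  apply/forall_inP=> a aP; apply/forall_inP=> b bP.
  have : connect (state_edge Abar) a b.
    by apply: connect_trans (Pback b bP); rewrite inE in aP.
  case/connectP=> p + bE; rewrite {b}bE in bP *.
  elim: p a aP bP => [|c p IH] a aP /= bP; first by rewrite connect0.
  case/andP=> ac cp.
  have cP : c \in P x.
    apply: connect_pred_closed bP => //; apply/connectP; by exists p.
  by apply: connect_trans (IH c cP bP cp); apply: connect1; rewrite /= aP cP.
have mP S' : strongly_connected Abar S' -> ~~ [disjoint S' & P x] -> S' \subset P x.
  move=> sS' /pred0Pn[y /andP[/= yS yP]]; exact: strongly_connected_sub sS' pP yS yP.
exists (P x); last exact: PQ.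
rewrite inE; apply/andP; split.
  apply/maxsetP; split=> // S' sS' PS'; apply/eqP; rewrite eqEsubset PS' andbT.
  by apply: mP => //; apply/pred0Pn; exists x; rewrite /= (subsetP PS') inE connect0.
apply/forallP=> S'; apply/implyP=> /andP[/maxsetP[sS' maxS'] nS'].
apply/forall_inP=> y yS'; apply/forall_inP=> z zP; apply: contra nS' => yz.
apply/eqP/esym; apply: maxS' => //; apply: mP => //.
by apply/pred0Pn; exists y; rewrite /= yS' (pP _ _ zP yz).
Qed.

End Components.

(** * Reachable vectors *)

(** Membership in the smallest [A]-invariant subspace containing the basis vectors
    of [U], expressed by duality: [x] is killed by every row vector that kills
    all the [A ^+ k e_u]. *)
Definition reachable (F : fieldType) (N : nat) (U : {set 'I_N.+1})
    (A : 'M[F]_N.+1) (x : 'cV[F]_N.+1) : Prop :=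
  forall z : 'rV[F]_N.+1,
    (forall k u, u \in U -> z *m A ^+ k *m delta_mx u (0 : 'I_1) = 0) ->
    z *m x = 0.

Section Reachable.
Variables (F : fieldType) (N : nat) (U : {set 'I_N.+1}) (A : 'M[F]_N.+1).

Lemma reachable_input u : u \in U -> reachable U A (delta_mx u 0).
Proof. by move=> uU z /(_ 0%N u uU); rewrite expr0 mulmx1. Qed.

Lemma reachable0 : reachable U A 0.
Proof. by move=> z _; rewrite mulmx0. Qed.

Lemma reachableD x y :
  reachable U A x -> reachable U A y -> reachable U A (x + y).
Proof. by move=> rx ry z hz; rewrite mulmxDr rx // ry // addr0. Qed.

Lemma reachableZ a x : reachable U A x -> reachable U A (a *: x).
Proof. by move=> rx z hz; rewrite -scalemxAr rx // scaler0. Qed.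

Lemma reachable_mul x : reachable U A x -> reachable U A (A *m x).
Proof.
move=> rx z hz; rewrite mulmxA; apply: rx => k u uU.
by rewrite -(mulmxA z) mulmxE -exprS; apply: hz.
Qed.

Lemma reachable_horner p x :
  reachable U A x -> reachable U A (horner_mx A p *m x).
Proof.
move=> rx; elim/poly_ind: p => [|p c IH].
  by rewrite rmorph0 mul0mx; apply: reachable0.
rewrite rmorphD rmorphM /= horner_mx_X horner_mx_C mulmxDl mul_scalar_mx.
apply: reachableD; last exact: reachableZ.
rewrite -mulmxE (comm_horner_mx p (erefl (A *m A))) -mulmxA.
exact: reachable_mul.
Qed.

Lemma reachable_scalar a x : a != 0 -> reachable U A (a *: x) -> reachable U A x.
Proof. by move=> a0 /(reachableZ a^-1); rewrite scalerA mulVf // scale1r. Qed.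

End Reachable.


(** * Choosing the weight of a cycle *)

(** The gcd's of [g] with the [p i] are nonconstant and pairwise coprime, so their
    product divides [g]. *)
Lemma many_common_factors (F : fieldType) (g : {poly F}) (p : nat -> {poly F})
    (M : nat) :
  g != 0 ->
  (forall i j, (i < j)%N -> coprimep (p i) (p j)) ->
  (forall i, (i < M)%N -> ~~ coprimep (p i) g) -> (M < size g)%N.
Proof.
move=> g0 cop ncop.
suff H : forall k, (k <= M)%N ->
    (k < size (gcdp g (\prod_(i < k) p i)))%N.
  by apply: leq_trans (H M (leqnn M)) _; apply: leq_gcdpl.
elim=> [|k IH] kM; first by rewrite big_ord0 (eqp_size (gcdp1 g)) size_poly1.
rewrite big_ord_recr /=; set P := \prod_(i < k) p i; set q := p k.
have copPq : coprimep P q.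
  rewrite /P; elim/big_rec : _ => [|i x _ hx]; first exact: coprime1p.
  by rewrite coprimepMl hx cop.
have sq : (1 < size (gcdp g q))%N.
  have := ncop k kM; rewrite coprimep_sym /coprimep.
  have : gcdp g q != 0 by rewrite gcdp_eq0 negb_and g0.
  by rewrite -size_poly_gt0; case: (size _) => [|[|?]].
have dv : gcdp g P * gcdp g q %| gcdp g (P * q).
  rewrite Gauss_dvdp; last first.
    apply: coprimep_dvdl (dvdp_gcdr g q) _; rewrite coprimep_sym.
    apply: coprimep_dvdl (dvdp_gcdr g P) _; rewrite coprimep_sym //.
  rewrite !dvdp_gcd !dvdp_gcdl /=.
  by rewrite (dvdp_mulr _ (dvdp_gcdr g P)) (dvdp_mull _ (dvdp_gcdr g q)).
have g1 : gcdp g (P * q) != 0 by rewrite gcdp_eq0 negb_and g0.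
apply: leq_trans (dvdp_leq g1 dv).
have a0 : gcdp g P != 0 by rewrite gcdp_eq0 negb_and g0.
have b0 : gcdp g q != 0 by rewrite gcdp_eq0 negb_and g0.
rewrite size_mul //; have := IH (ltnW kM).
move: sq; rewrite -/P; case: (size (gcdp g q)) => [|[|s]] // _.
by rewrite addnS /= addnS ltnS => h; apply: leq_trans h (leq_addr _ _).
Qed.

(** The polynomials ['X^l - a] are pairwise coprime, and only finitely many of them
    can share a factor with [g]; the candidates are [lam = 1, 2, 3, ...]. *)
Lemma coprime_power_shift (R : realFieldType) (g : {poly R}) (l : nat) :
  g != 0 -> (0 < l)%N ->
  exists2 lam : R, lam != 0 & coprimep ('X^l - (lam ^+ l)%:P) g.
Proof.
move=> g0 l0; pose p (i : nat) : {poly R} := 'X^l - ((i.+1%:R : R) ^+ l)%:P.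
case: (boolP [exists i : 'I_(size g), coprimep (p i) g]) => [/existsP[i hi]|].
  by exists i.+1%:R; rewrite ?pnatr_eq0.
rewrite negb_exists => /forallP h.
suff : (size g < size g)%N by rewrite ltnn.
apply: (@many_common_factors _ g p) => // [i j ij|i ig]; last exact: (h (Ordinal ig)).
apply/Bezout_coprimepP.
pose c : R := j.+1%:R ^+ l - i.+1%:R ^+ l.
have c0 : c != 0.
  by rewrite subr_eq0 eqrXn2 ?ler0n // eqr_nat gt_eqF.
exists (1, -1); rewrite /= mul1r mulN1r /p opprB addrC addrA subrK.
by rewrite -polyCB -/c -size_poly_eq1 size_polyC c0.
Qed.

(** [markov_poly h d] is [h 0 * 'X^(d-1) + ... + h (d-1)], the polynomial part of
    ['X^d] times the power series [\sum_i h i / 'X^(i+1)].  Accordingly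
    [markov_num h chi] is the polynomial part of [chi] times that series: if the
    [h i] are the Markov parameters of a system with characteristic polynomial
    [chi], it is the numerator of its transfer function. *)
Definition markov_poly (F : fieldType) (h : nat -> F) (d : nat) : {poly F} :=
  \poly_(t < d) h (d.-1 - t)%N.

Lemma markov_polyS (F : fieldType) (h : nat -> F) d :
  markov_poly h d.+1 = 'X * markov_poly h d + (h d)%:P.
Proof.
apply/polyP=> i; rewrite coefD coefXM coefC !coef_poly /=.
case: i => [|i] /=; first by rewrite subn0 add0r.
by rewrite addr0 ltnS; case: ltnP => // lt_id; congr (h _); lia.
Qed.

Definition markov_num (F : fieldType) (h : nat -> F) (chi : {poly F}) :=
  \sum_(d < size chi) chi`_d *: markov_poly h d.

(** With [D] the degree of [chi] and [h d0] the first nonzero term, the coefficient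
    of index [D - d0 - 1] is the product of [h d0] and the leading coefficient. *)
Lemma markov_num_neq0 (F : fieldType) (h : nat -> F) (chi : {poly F}) d0 :
  h d0 != 0 -> (forall d, (d < d0)%N -> h d = 0) -> (d0.+1 < size chi)%N ->
  markov_num h chi != 0.
Proof.
move=> hd0 hlt; rewrite /markov_num.
have := lead_coef_eq0 chi; rewrite lead_coefE -size_poly_eq0.
case: (size chi) => [//|D] /= lc; rewrite ltnS => ltD.
apply/eqP=> /(congr1 (coefp (D - d0.+1))) /=.
rewrite coef0 coef_sum big_ord_recr /= big1 => [|d _]; last first.
  rewrite coefZ coef_poly; case: ltnP => ltd; rewrite ?mulr0 //.
  by rewrite hlt ?mulr0 //; have := ltn_ord d; lia.
rewrite add0r coefZ coef_poly ifT; last by lia.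
have -> : (D.-1 - (D - d0.+1) = d0)%N by lia.
by apply/eqP; rewrite mulf_neq0 // lc.
Qed.

Lemma horner_mx_coef (F : fieldType) N (A : 'M[F]_N.+1) (chi : {poly F}) :
  horner_mx A chi = \sum_(d < size chi) chi`_d *: A ^+ d.
Proof.
rewrite -{1}(coefK chi) poly_def rmorph_sum /=; apply: eq_bigr => d _.
by rewrite horner_mxZ rmorphXn /= horner_mx_X.
Qed.

(** On the vectors [A ^+ d *m b] the matrix [A'] acts as [A] up to a multiple of [c];
    by induction each power of [A'] applied to [b] differs from that of [A] by a
    polynomial in [A'] applied to [c].  When [chi] annihilates [A] only the last
    term is left. *)
Lemma horner_transfer (F : fieldType) N (A A' : 'M[F]_N.+1)
    (b c : 'cV[F]_N.+1) (h : nat -> F) :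
  (forall d, A' *m (A ^+ d *m b) = A ^+ d.+1 *m b + h d *: c) ->
  forall chi, horner_mx A' chi *m b =
    horner_mx A chi *m b + horner_mx A' (markov_num h chi) *m c.
Proof.
move=> step.
have pow d : A' ^+ d *m b = A ^+ d *m b + horner_mx A' (markov_poly h d) *m c.
  elim: d => [|d IH].
    have -> : markov_poly h 0 = 0 by apply/polyP=> i; rewrite coef_poly coef0.
    by rewrite rmorph0 mul0mx addr0.
  rewrite exprS -mulmxE -mulmxA IH mulmxDr step markov_polyS rmorphD rmorphM /=.
  by rewrite horner_mx_X horner_mx_C mulmxDl mul_scalar_mx -mulmxE mulmxA addrA addrAC.
move=> chi; rewrite (horner_mx_coef A) (horner_mx_coef A' chi) /markov_num.
rewrite rmorph_sum /= !mulmx_suml -big_split /=.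
apply: eq_bigr => d _.
by rewrite horner_mxZ -!scalemxAl pow scalerDr.
Qed.

(** * A realization that reaches every vertex *)

(** The weight [A i j] sits on the edge from [j] to [i]; [U] is the set of inputs,
    which receive no edge, and [S] contains both ends of every weighted edge. *)
Definition weighting (F : fieldType) N (U : {set 'I_N.+1}) (E : rel 'I_N.+1)
    (S : {set 'I_N.+1}) (A : 'M[F]_N.+1) : Prop :=
  forall i j, A i j != 0 -> [&& i \in S, j \in S, i \notin U & E j i].

(** Put weight 1 on the edges from [s x] to [x] for the states [x] whose orbit meets
    [U].  As [s] is injective, [s x] is the tail of the edge to [x] only, so [A] maps
    its basis vector to that of [x]; walking along [s] from [x] one ends at an
    input. *)
Lemma stems_reachable (F : fieldType) N (U : {set 'I_N.+1}) (E : rel 'I_N.+1)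
    (s : {perm 'I_N.+1}) :
  (forall x, x \notin U -> E (s x) x) ->
  exists (S : {set 'I_N.+1}) (A : 'M[F]_N.+1),
    [/\ U \subset S, forall x, (s x \in S) = (x \in S), weighting U E S A
      & forall x, x \in S -> reachable U A (delta_mx x 0)].
Proof.
move=> sE; pose S := [set x | [exists u in U, u \in porbit s x]].
have sS x : (s x \in S) = (x \in S).
  by rewrite !inE -(porbit_perm s 1 x) expg1.
pose A : 'M[F]_N.+1 := \matrix_(i, j) [&& i \in S, i \notin U & j == s i]%:R.
exists S, A; split=> //.
- by apply/subsetP=> u uU; rewrite inE; apply/existsP; exists u; rewrite uU porbit_id.
- move=> i j; rewrite mxE; case: and3P => [[iS iU /eqP ->] _|]; last by rewrite eqxx.
  by rewrite iS sS iS iU sE.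
have Ae x : x \in S -> x \notin U -> A *m delta_mx (s x) (0 : 'I_1) = delta_mx x 0.
  move=> xS xU; apply/matrixP=> i j; rewrite ord1 -colE !mxE eqxx andbT.
  rewrite (inj_eq perm_inj) eq_sym; case: eqP => [->|_]; last by rewrite !andbF.
  by rewrite xS xU.
move=> x xS; have : exists k, (s ^+ k)%g x \in U.
  move: xS; rewrite inE => /existsP[u /andP[uU /porbitP[k uE]]].
  by exists k; rewrite -uE.
case=> k; elim: k x xS => [|k IH] x xS.
  by rewrite expg0 perm1; apply: reachable_input.
rewrite expgS permM => sU; case: (boolP (x \in U)) => [|xU].
  exact: reachable_input.
by rewrite -Ae //; apply: reachable_mul; apply: IH; rewrite ?sS.
Qed.

(** Otherwise the row vector dual to [p] would kill all that is reachable. *)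
Lemma reachable_markov (F : fieldType) N (U : {set 'I_N.+1}) (A : 'M[F]_N.+1) p :
  reachable U A (delta_mx p 0) ->
  exists u k, u \in U /\ (A ^+ k *m delta_mx u (0 : 'I_1)) p 0 != 0.
Proof.
move=> rp; apply: contrapT => H.
have : (delta_mx 0 p : 'rV[F]_N.+1) *m delta_mx p (0 : 'I_1) = 0.
  apply: rp => k u uU; rewrite -mulmxA -rowE; apply/matrixP=> i j.
  rewrite !ord1 [LHS]mxE [RHS]mxE; apply/eqP/negPn/negP=> h.
  by apply: H; exists u, k.
rewrite mul_delta_mx => /matrixP/(_ 0 0).
by rewrite !mxE !eqxx /= => /eqP; rewrite oner_eq0.
Qed.

(** The orbit of [c] is a cycle of states disjoint from [S].  It gets a common
    weight [lam] on its edges, and weight 1 is put on the edge from [p] to [c].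
    The number [lam] is chosen so that [lam ^+ l], with [l] the length of the cycle,
    is not the [l]-th power of any root of [g], the numerator of the transfer
    function from an input [u] to [p]. *)
Lemma add_cycle_reachable (R : realFieldType) N (U S : {set 'I_N.+1})
    (E : rel 'I_N.+1) (s : {perm 'I_N.+1}) (A : 'M[R]_N.+1) p c :
  (forall x, x \notin U -> E (s x) x) ->
  U \subset S -> (forall x, (s x \in S) = (x \in S)) -> weighting U E S A ->
  (forall x, x \in S -> reachable U A (delta_mx x 0)) ->
  p \in S -> c \notin S -> E p c ->
  exists A' : 'M[R]_N.+1,
    weighting U E (S :|: porbit s c) A' /\
    forall x, x \in S :|: porbit s c -> reachable U A' (delta_mx x 0).
Proof.
move=> sE US sS wA rA pS cS Epc; set C := porbit s c.
have CS x : x \in C -> x \notin S.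
  case/porbitP=> k ->; elim: k => [|k]; first by rewrite expg0 perm1.
  by rewrite expgSr permM sS.
have sC x : x \in C -> s x \in C.
  by case/porbitP=> k ->; rewrite -permM -expgSr mem_porbit.
have cC : c \in C by apply: porbit_id.
have notU x : x \notin S -> x \notin U by apply: contra; apply: (subsetP US).
have [u [k0 [uU hk0]]] := reachable_markov (rA p pS).
pose h d := (A ^+ d *m delta_mx u (0 : 'I_1)) p 0.
have exh : exists d, h d != 0 by exists k0.
pose d0 := ex_minn exh.
have [hd0 hmin] : h d0 != 0 /\ forall d, (d < d0)%N -> h d = 0.
  rewrite /d0; case: ex_minnP => m hm lem; split=> // d ltd; apply/eqP/negPn/negP.
  by move=> /lem; rewrite leqNgt ltd.
(* The factor ['X^(d0.+1)] makes the degree exceed [d0]. *)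
pose chi := 'X^(d0.+1) * char_poly A.
have chiA : horner_mx A chi = 0 by rewrite rmorphM /= Cayley_Hamilton mulr0.
have schi : (d0.+1 < size chi)%N.
  have m := char_poly_monic A.
  by rewrite size_Mmonic ?monic_neq0 ?monicXn // size_polyXn size_char_poly; lia.
pose g := markov_num h chi.
have g0 : g != 0 by apply: markov_num_neq0 hd0 hmin schi.
pose l := #|C|.
have l0 : (0 < l)%N by apply/card_gt0P; exists c.
have [lam lam0 cop] := coprime_power_shift g0 l0.
pose P : 'M[R]_N.+1 := \matrix_(i, j) ((i \in C) && (j == s i))%:R.
pose A' : 'M[R]_N.+1 := A + lam *: P + delta_mx c p.
have wA' : weighting U E (S :|: C) A'.
  move=> i j; rewrite !mxE !in_setU; case: (eqVneq (A i j) 0) => [->|nz _].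
    rewrite add0r; case: (boolP (i \in C)) => [iC|iC] /=.
      case: (eqVneq j (s i)) => [-> _|_].
        by rewrite (sC _ iC) !orbT (notU _ (CS _ iC)) sE ?notU ?CS.
      rewrite mulr0 add0r; case: (eqVneq i c) => [->|_]; last by rewrite eqxx.
      by case: (eqVneq j p) => [->|_]; rewrite ?eqxx // pS (notU _ cS) Epc !orbT.
    rewrite mulr0 add0r; case: (eqVneq i c) => [ic|_]; last by rewrite eqxx.
    by rewrite ic cC in iC.
  by have /and4P[-> -> -> ->] := wA _ _ nz.
exists A'; split=> //.
have A'C x : x \in C -> A' *m delta_mx (s x) (0 : 'I_1) = lam *: delta_mx x 0.
  move=> xC; apply/matrixP=> i j; rewrite ord1 -colE !mxE eqxx andbT.
  rewrite (inj_eq perm_inj) [x == i]eq_sym.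
  have -> : A i (s x) = 0.
    apply/eqP/negPn/negP=> /wA/and4P[_ + _ _].
    by rewrite sS (negPf (CS x xC)).
  have -> : (s x == p) = false.
    by apply/eqP=> sxp; move: pS; rewrite -sxp sS (negPf (CS x xC)).
  rewrite andbF add0r addr0; case: eqP => [->|_]; last by rewrite andbF.
  by rewrite xC.
(* On vectors supported on the old part, only the edge from [p] to [c] is new. *)
have A'S (x : 'cV[R]_N.+1) : (forall i, i \notin S -> x i 0 = 0) ->
    A' *m x = A *m x + x p 0 *: delta_mx c 0.
  move=> xS; rewrite /A' !mulmxDl -scalemxAl.
  have -> : P *m x = 0.
    apply/matrixP=> i j; rewrite ord1 !mxE big1 // => k _; rewrite mxE.
    case: andP => [[iC /eqP ->]|_]; last by rewrite mul0r.
    by rewrite xS ?mulr0 // CS // sC.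
  rewrite scaler0 addr0; congr (_ + _); apply/matrixP=> i j.
  rewrite ord1 !mxE (bigD1 p) //= big1 => [|k kp]; rewrite !mxE ?(negPf kp) ?andbF ?mul0r //.
  by rewrite !eqxx !andbT addr0 mulrC.
(* No edge of [A] leaves [S], so the old iterates stay supported on [S]. *)
have supp v d i : v \in U -> i \notin S -> (A ^+ d *m delta_mx v (0 : 'I_1)) i 0 = 0.
  move=> vU iS; case: d => [|d].
    rewrite expr0 mul1mx mxE eqxx andbT; case: eqP => // iv.
    by rewrite iv (subsetP US) in iS.
  rewrite exprS -mulmxE -mulmxA mxE big1 // => k _.
  have -> : A i k = 0 by apply/eqP/negPn/negP=> /wA/and4P[]; rewrite (negPf iS).
  by rewrite mul0r.
have tr := horner_transfer (fun d => _ : A' *m (A ^+ d *m delta_mx u (0 : 'I_1)) =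
  A ^+ d.+1 *m delta_mx u 0 + h d *: delta_mx c 0).
have {}tr chi' : horner_mx A' chi' *m delta_mx u (0 : 'I_1) =
    horner_mx A chi' *m delta_mx u 0 + horner_mx A' (markov_num h chi') *m delta_mx c 0.
  apply: tr => d; rewrite A'S; last by move=> i; apply: supp.
  by rewrite exprS -mulmxE -mulmxA.
have powC k x : x \in C ->
    A' ^+ k *m delta_mx ((s ^+ k)%g x) (0 : 'I_1) = lam ^+ k *: delta_mx x 0.
  move=> xC; elim: k => [|k IH]; first by rewrite !expr0 expg0 perm1 mul1mx scale1r.
  have skC : (s ^+ k)%g x \in C by case/porbitP: xC => j ->; rewrite -permM -expgD mem_porbit.
  by rewrite exprSr expgSr permM -mulmxE -mulmxA A'C // -scalemxAr IH scalerA -exprS.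
have annC : horner_mx A' ('X^l - (lam ^+ l)%:P) *m delta_mx c (0 : 'I_1) = 0.
  have := powC l c cC; rewrite permX iter_porbit => h1.
  by rewrite rmorphB /= rmorphXn /= horner_mx_X horner_mx_C mulmxBl h1 mul_scalar_mx subrr.
have gc : reachable U A' (horner_mx A' g *m delta_mx c 0).
  have := tr chi; rewrite chiA mul0mx add0r => <-.
  exact/reachable_horner/reachable_input.
(* In the Bezout relation for ['X^l - lam ^+ l] and [g], the first term kills
   the basis vector of [c] and the second one makes it reachable. *)
have rc : reachable U A' (delta_mx c 0).
  have /Bezout_eq1_coprimepP[[a b] /= ab1] := cop.
  rewrite -(mul1mx (delta_mx c 0)) -[1%:M](rmorph1 (horner_mx A')) -ab1 rmorphD !rmorphM /=.
  rewrite mulmxDl -!mulmxE -!mulmxA annC mulmx0 add0r.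
  exact: reachable_horner.
(* Walking along the cycle from [c]: [A'] maps the basis vector of [s x] to [lam]
   times that of [x]. *)
have rC x : x \in C -> reachable U A' (delta_mx x 0).
  rewrite /C porbit_sym => /porbitP[k cE].
  have xC : x \in C by rewrite /C porbit_sym cE mem_porbit.
  apply: (reachable_scalar (expf_neq0 k lam0)); rewrite -powC // -cE.
  by elim: k {cE} => [|k IH]; [rewrite expr0 mul1mx |
    rewrite exprS -mulmxE -mulmxA; apply: reachable_mul].
move=> x; rewrite in_setU => /orP[xS|]; last exact: rC.
(* On an old iterate, [A] and [A'] differ by a multiple of the basis vector of [c],
   which is reachable by now. *)
move=> z hz; apply: (rA x xS) => k v vU.
rewrite -mulmxA; move: z hz; rewrite -/(reachable U A' _).
elim: k => [|k IH]; first by rewrite expr0 mul1mx; apply: reachable_input.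
have := A'S (A ^+ k *m delta_mx v 0) (fun i => @supp v k i vU).
move/esym/(canRL (addrK _)); rewrite mulmxA mulmxE -exprS => ->.
by apply: reachableD; [exact: reachable_mul | rewrite -scaleNr; exact: reachableZ].
Qed.

(** Starting from the chains, cycles are added until all vertices are reached. *)
Lemma reachable_realization (R : realFieldType) N (U : {set 'I_N.+1})
    (E : rel 'I_N.+1) (s : {perm 'I_N.+1}) :
  (forall x, x \notin U -> E (s x) x) ->
  (forall S : {set 'I_N.+1}, U \subset S -> S != setT ->
     exists p c, [/\ p \in S, c \notin S & E p c]) ->
  exists2 A : 'M[R]_N.+1,
    weighting U E setT A & forall x, reachable U A (delta_mx x 0).
Proof.
move=> sE acc.
have [S0 [A0 H]] := stems_reachable R sE.
have [k] := ubnP #|~: S0|; elim: k S0 A0 H => // k IH S A [US sS wA rA].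
rewrite ltnS => leSk; case: (eqVneq S setT) => [ST|nT].
  by exists A => [|x]; [rewrite -ST | apply: rA; rewrite ST inE].
have [p [c [pS cS Epc]]] := acc S US nT.
have [A' [wA' rA']] := add_cycle_reachable sE US sS wA rA pS cS Epc.
apply: (IH (S :|: porbit s c) A').
  split=> //; first exact: subset_trans US (subsetUl _ _).
  by move=> x; rewrite !in_setU sS ![_ \in porbit s c]porbit_sym -(porbit_perm s 1 x) expg1.
apply: leq_trans leSk; apply: proper_card; rewrite properC; apply/properP.
by split; [exact: subsetUl | exists c; rewrite // inE porbit_id orbT].
Qed.


(** * Structural controllability *)

Section Controllable.
Variables (R : realType) (n m : nat) (A : 'M[R]_n) (B : 'M[R]_(n, m)).

Lemma controllable_ker (v : 'rV[R]_n) :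
  controllable A B -> (forall k, v *m (A ^+ k *m B) = 0) -> v = 0.
Proof.
rewrite /controllable => rk hv.
have rf : row_free (controllability_mx A B) by rewrite /row_free rk.
apply: (row_free_inj rf); rewrite mul0mx /controllability_mx mul_mxrow.
by rewrite -[RHS]mxrow0; apply: eq_mxrow => i; rewrite hv.
Qed.

End Controllable.

(** The controllability matrix only contains the powers of [A] below its size; the
    other powers are combinations of these by the Cayley-Hamilton theorem. *)
Lemma ker_controllable (R : realType) (n m : nat) (A : 'M[R]_n.+1)
    (B : 'M[R]_(n.+1, m)) :
  (forall v : 'rV[R]_n.+1, (forall k, v *m (A ^+ k *m B) = 0) -> v = 0) ->
  controllable A B.
Proof.
move=> hv; apply/eqP/inj_row_free => v hz; apply: hv => k.
have low i : (i < n.+1)%N -> v *m (A ^+ i *m B) = 0.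
  move: hz; rewrite /controllability_mx mul_mxrow -[RHS]mxrow0 => /eq_mxrowP hz ltin.
  exact: (hz (Ordinal ltin)).
have -> : A ^+ k = horner_mx A ('X^k %% char_poly A).
  rewrite -{1}(horner_mx_X A) -rmorphXn /= {1}(divp_eq 'X^k (char_poly A)).
  by rewrite rmorphD rmorphM /= Cayley_Hamilton mulr0 add0r.
rewrite horner_mx_coef mulmx_suml mulmx_sumr big1 // => d _.
rewrite -scalemxAl -scalemxAr low ?scaler0 //.
apply: leq_trans (ltn_ord d) _; rewrite -ltnS -(size_char_poly A).
by rewrite ltn_modp monic_neq0 ?char_poly_monic.
Qed.

Section Blocks.
Variables (n m : nat) (Abar : 'M[bool]_n.+1) (Bbar : 'M[bool]_(n.+1, m)).

Definition input_set : {set 'I_(n.+1 + m)} := [set rshift n.+1 j | j : 'I_m].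

(** The state digraph together with an edge from input [j] to state [i] for each
    star [Bbar i j]; states are the left summand of the vertex set. *)
Definition pattern_edge : rel 'I_(n.+1 + m) := fun p x =>
  if split x is inl i then row_mx Abar Bbar i p else false.

(** [M] is the block matrix with rows [A B] and [0 0].  If [v] kills all the
    [A ^+ k *m B], then the powers of [M] map the row vector [(v, 0)] to vectors
    whose input coordinates vanish, and reachability of all vertices gives
    [v = 0]. *)
Lemma controllable_of_reachable (R : realType) (M : 'M[R]_((n + m).+1)) :
  weighting input_set pattern_edge setT M ->
  (forall x, reachable input_set M (delta_mx x 0)) ->
  structurally_controllable R Abar Bbar.
Proof.
move=> wM rM; pose M' : 'M[R]_(n.+1 + m) := M.
exists (ulsubmx M'), (ursubmx M'); split.
- move=> i j Aij; rewrite !mxE; apply/eqP/negPn/negP => /wM /and4P[_ _ _].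
  by rewrite /pattern_edge (unsplitK (inl i)) row_mxEl Aij.
- move=> i j Bij; rewrite !mxE; apply/eqP/negPn/negP => /wM /and4P[_ _ _].
  by rewrite /pattern_edge (unsplitK (inl i)) row_mxEr Bij.
set A := ulsubmx M'; set B := ursubmx M'.
have dM : dsubmx M' = 0.
  apply/matrixP=> i j; rewrite !mxE; apply/eqP/negPn/negP => /wM /and4P[_ _].
  by rewrite imset_f.
have ME : M' = block_mx A B 0 0.
  by rewrite -[LHS]submxK /dlsubmx /drsubmx dM linear0 linear0.
apply: ker_controllable => v hv.
pose z : 'rV[R]_(n.+1 + m) := row_mx v 0.
have zM k : z *m M' ^+ k.+1 = row_mx (v *m A ^+ k.+1) (v *m (A ^+ k *m B)).
  elim: k => [|k IH].
    by rewrite expr1 ME mul_row_block !mulmx0 !addr0 expr1 expr0 mul1mx.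
  rewrite exprSr -mulmxE mulmxA IH [in LHS]ME mul_row_block !mulmx0 !addr0.
  by rewrite -!mulmxA -[A ^+ k.+1 *m A]exprSr.
suff z0 : z = 0 by move: z0; rewrite -[RHS]row_mx0 => /eq_row_mx[].
apply/rowP=> x; rewrite [RHS]mxE.
have := rM x z; rewrite -colE => rxz.
suff /rxz/matrixP/(_ 0 0) : forall k u, u \in input_set ->
    z *m (M : 'M_((n + m).+1)) ^+ k *m delta_mx u (0 : 'I_1) = 0 by rewrite !mxE.
move=> k u /imsetP[j _ ->]; rewrite -colE; apply/colP=> i; rewrite ord1 [LHS]mxE [RHS]mxE.
case: k => [|k].
  by rewrite expr0 mulmx1 //; have := row_mxEr v (0 : 'rV_m) 0 j; rewrite [RHS]mxE.

have := row_mxEr (v *m A ^+ k.+1) (v *m (A ^+ k *m B)) 0 j.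
by rewrite -zM hv [RHS]mxE.
Qed.
End Blocks.

(** By [ntl_in_pred_closed] this says that every state is reached from some input. *)
Definition accessible (n m : nat) (Abar : 'M[bool]_n) (Bbar : 'M[bool]_(n, m)) :=
  forall N, N \in ntl_sccs Abar -> exists x j, x \in N /\ Bbar x j.

Definition hall_rows (n p : nat) (M : 'M[bool]_(n, p)) :=
  forall S : {set 'I_n}, (#|S| <= #|[set y | [exists k in S, M k y]]|)%N.

(** Hall's theorem is applied to all vertices, an input row being compatible with
    every column: the matching obtained is then a permutation of the vertices, as
    needed to split them into chains and cycles.  A set of vertices that contains
    the inputs and is left by no edge is everything: otherwise its complement
    would contain a non-top linked component, on which some input acts. *)
Lemma structural_sufficiency (R : realType) (n m : nat) (Abar : 'M[bool]_n)
    (Bbar : 'M[bool]_(n, m)) :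
  accessible Abar Bbar -> hall_rows (row_mx Abar Bbar) ->
  structurally_controllable R Abar Bbar.
Proof.
case: n Abar Bbar => [|n] Abar Bbar acc hr.
  exists 0, 0; split; [by move=> i j; rewrite mxE.. |].
  by apply/eqP; rewrite -leqn0 rank_leq_row.
pose r : {set 'I_(n.+1 + m) * 'I_(n.+1 + m)} :=
  [set q | if split q.1 is inl i then row_mx Abar Bbar i q.2 else true].
have rl i y : ((lshift m i, y) \in r) = row_mx Abar Bbar i y.
  by rewrite inE /= (unsplitK (inl i)).
have rr j y : (rshift n.+1 j, y) \in r by rewrite inE /= (unsplitK (inr j)).
have /hall[f inj_f fr] : hall_cond r.
  apply/forallP=> S.
  case: (boolP [exists j, rshift n.+1 j \in S]) => [/existsP[j jS]|].
    apply: leq_trans (max_card S) _; rewrite -cardsT; apply: subset_leq_card.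
    by apply/subsetP=> y _; apply/hall_nbrsP; exists (rshift n.+1 j).
  rewrite negb_exists => /forallP nS; pose S' := [set i | lshift m i \in S].
  have -> : S = lshift m @: S'.
    apply/setP=> x; case: (split_ordP x) => i ->.
      by rewrite mem_imset ?inE //; exact: lshift_inj.
    rewrite (negPf (nS i)); apply/esym/negP=> /imsetP[k _ /eqP].
    by rewrite eq_rlshift.
  rewrite card_imset; last exact: lshift_inj.
  apply: leq_trans (hr S') (subset_leq_card _); apply/subsetP=> y.
  rewrite inE => /existsP[k /andP[kS kM]]; apply/hall_nbrsP.
  by exists (lshift m k); rewrite ?rl // imset_f.
pose s : {perm 'I_(n + m).+1} := perm inj_f.
have notU x : x \notin input_set n m -> exists i, x = lshift m i.
  case: (split_ordP x) => i -> h; first by exists i.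
  by rewrite imset_f in h.
have [||M wM rM] := @reachable_realization R (n + m) (input_set n m) (pattern_edge Abar Bbar) s.
- move=> x /notU[i xE]; rewrite /pattern_edge xE (unsplitK (inl i)).
  by rewrite -rl permE.
- move=> S0 US nT; pose S : {set 'I_(n.+1 + m)} := S0; rewrite -/S in US nT *.
  pose Q := [set i | lshift m i \notin S].
  have Q0 : Q != set0.
    apply: contraNneq nT => Q0; apply/eqP/setP=> x; rewrite inE.
    case: (boolP (x \in input_set n m)) => [/(subsetP US)//|/notU[i ->]].
    by move/setP/(_ i): Q0; rewrite !inE => /negbT; rewrite negbK.
  apply: contrapT => noedge.
  have pQ : pred_closed Abar Q.
    move=> y x; rewrite !inE => xS yx; apply/negP=> yS; apply: noedge.
    exists (lshift m y), (lshift m x); split=> //.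
    by rewrite /pattern_edge (unsplitK (inl x)) row_mxEl.
  have [N Nntl /subsetP NQ] := ntl_in_pred_closed Q0 pQ.
  have [x [j [xN Bxj]]] := acc N Nntl; apply: noedge.
  exists (rshift n.+1 j), (lshift m x); split.
  + by apply: (subsetP US); rewrite imset_f.
  + by have := NQ x xN; rewrite inE.
  + by rewrite /pattern_edge (unsplitK (inl x)) row_mxEr.
exact: controllable_of_reachable wM rM.
Qed.

(** The powers of [A] map row vectors supported on a non-top linked component to
    such vectors, and [B] vanishes on the rows of a component without inputs. *)
Lemma controllable_accessible (R : realType) (n m : nat) (Abar : 'M[bool]_n)
    (Bbar : 'M[bool]_(n, m)) :
  structurally_controllable R Abar Bbar -> accessible Abar Bbar.
Proof.
case=> A [B [rA rB cAB]] N ntlN.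
apply: contrapT => noB.
have [x xN] := ntl_neq0 ntlN.
have pN := ntl_pred_closed ntlN.
have : (delta_mx 0 x : 'rV[R]_n) = 0.
  apply: (controllable_ker cAB) => k.
  pose v k : 'rV[R]_n := delta_mx 0 x *m A ^+ k.
  have sv i : i \notin N -> v k 0 i = 0.
    elim: k i => [|k IH] i iN.
      rewrite /v expr0 mulmx1 mxE /=; case: eqP => // ix.
      by rewrite ix xN in iN.
    rewrite /v exprSr -mulmxE mulmxA mxE big1 // => l _.
    case: (boolP (l \in N)) => lN; last by rewrite IH ?mul0r.
    rewrite rA ?mulr0 //; apply/negP=> /(pN i l lN) iN'.
    by rewrite iN' in iN.
  rewrite mulmxA; apply/rowP=> j; rewrite !mxE big1 // => l _.
  case: (boolP (l \in N)) => lN; last by rewrite sv ?mul0r.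
  rewrite rB ?mulr0 //; apply/negP=> Bl; apply: noB; by exists l, j.
by move/matrixP/(_ 0 x); rewrite !mxE !eqxx => /eqP; rewrite oner_eq0.
Qed.

(** The matrix [[A B]] has full row rank, as a row vector that it kills is killed by
    the whole controllability matrix.  The rows of an invertible square submatrix of
    its transpose are columns of [[A B]]; a nonzero term in the Leibniz expansion
    of the determinant assigns to them distinct rows with nonzero entries. *)
Lemma controllable_matching (R : realType) (n m : nat) (Abar : 'M[bool]_n)
    (Bbar : 'M[bool]_(n, m)) :
  structurally_controllable R Abar Bbar ->
  exists2 f : 'I_n -> 'I_(n + m), injective f &
    forall k, row_mx Abar Bbar k (f k).
Proof.
case=> A [B [rA rB cAB]].
have rM : realizes (row_mx Abar Bbar) (row_mx A B).
  by move=> i y; case: (split_ordP y) => j ->; rewrite ?row_mxEl ?row_mxEr;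
    [apply: rA | apply: rB].
have : row_free (row_mx A B).
  apply/inj_row_free => v; rewrite mul_mx_row -row_mx0 => /eq_row_mx[vA vB].
  apply: (controllable_ker cAB) => -[|k]; first by rewrite expr0 mul1mx.
  by rewrite exprS -mulmxE -mulmxA mulmxA vA mul0mx.
rewrite /row_free -mxrank_tr -/(row_full _) => rf.
have := fullrowsub_unit rf; set D := rowsub _ _; set f := fullrankfun rf in D *.
rewrite unitmxE unitfE => detD.
have [t ht] : exists t : 'S_n, \prod_i D i (t i) != 0.
  apply: contrapT => H; case/negP: detD; rewrite /determinant big1 // => t _.
  apply/eqP; rewrite mulf_eq0; apply/orP; right; apply/negPn/negP => h.
  by apply: H; exists t.
exists (fun k => f (t^-1 k)%g) => [k1 k2 /fullrankfun_inj/perm_inj //|k].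
apply/negPn/negP => /negbTE/rM M0; case/eqP: ht.
have D0 : D (t^-1 k)%g (t (t^-1 k)%g) = 0 by rewrite permKV mxE [LHS]mxE M0.
by rewrite (bigD1 (t^-1 k)%g) //= D0 mul0r.
Qed.

(** * Flows in the network *)

Section NetworkSums.
Variables (R : realType) (n m : nat) (Abar : 'M[bool]_n) (Bbar : 'M[bool]_(n, m)).
Local Notation V := (net_vertex m Abar).
Implicit Types (f : net_edge Abar Bbar -> R).

(** The flow on a pair of vertices, extended by 0 to pairs that are not edges, so
    that sums over edges become sums over vertices. *)
Definition flow_on f (v w : V) : R := oapp f 0 (insub (v, w)).

Lemma flow_on_edge f (e : net_edge Abar Bbar) : flow_on f (val e).1 (val e).2 = f e.
Proof. by rewrite /flow_on -surjective_pairing valK. Qed.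

Lemma flow_on_nadj f v w : net_adj Bbar v w = false -> flow_on f v w = 0.
Proof. by move=> h; rewrite /flow_on insubF. Qed.

Lemma edge_sum f (P : pred (V * V)) :
  \sum_(e : net_edge Abar Bbar | P (val e)) f e =
  \sum_(q | P q) flow_on f q.1 q.2.
Proof.
transitivity (\sum_(e : net_edge Abar Bbar | P (val e)) flow_on f (val e).1 (val e).2).
  by apply: eq_bigr => e _; rewrite flow_on_edge.
rewrite -(big_sub_cond [pred q : V * V | net_adj Bbar q.1 q.2] P
  (fun q => flow_on f q.1 q.2)).
rewrite big_mkcondl /=; apply: eq_bigr => q _; rewrite inE.
by case: ifP => // /flow_on_nadj ->.
Qed.

Lemma outflowE f v : outflow f v = \sum_w flow_on f v w.
Proof.
rewrite /outflow (edge_sum f (fun q => q.1 == v)).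
have -> : \sum_w flow_on f v w = \sum_(a | a == v) \sum_w flow_on f a w.
  by rewrite big_pred1_eq.
rewrite pair_big /=.
by apply: eq_bigl => q; rewrite andbT.
Qed.

Lemma inflowE f v : inflow f v = \sum_w flow_on f w v.
Proof.
rewrite /inflow (edge_sum f (fun q => q.2 == v)).
have -> : \sum_w flow_on f w v = \sum_w \sum_(a | a == v) flow_on f w a.
  by apply: eq_bigr => w _; rewrite big_pred1_eq.
rewrite pair_big /=.
by apply: eq_bigl.
Qed.

Lemma vertex_sum (G : V -> R) :
  \sum_v G v = G Vs + G Vt + \sum_C G (VN C) + (\sum_k G (Vx' k) + \sum_r G (Vx r))
    + (\sum_j G (Vu j) + \sum_j G (Vu' j)).
Proof.
rewrite (reindex (@net_vertex_decode n m Abar)) /=; last first.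
  exists (@net_vertex_encode n m Abar) => c _; last exact: net_vertex_encodeK.
  by case: c => [[[[]|?]|[?|?]]|[?|?]].
rewrite !big_sumType /= big_bool /=; congr (_ + _ + _ + _).
Qed.
End NetworkSums.

Section NetworkFlows.
Variables (R : realType) (n m : nat) (Abar : 'M[bool]_n) (Bbar : 'M[bool]_(n, m)).
Local Notation V := (net_vertex m Abar).

Section Balance.
Variable G : V -> V -> R.
Hypothesis G0 : forall v w, net_adj Bbar v w = false -> G v w = 0.

(* Expands a sum over all vertices and drops the terms that carry no edge. *)
Ltac sum_edges := rewrite vertex_sum;
  repeat match goal with
  | |- context [\sum_i @?F i] =>
      rewrite (_ : \sum_i F i = 0); [|by apply: big1 => ? _; apply: G0]
  | |- context [G ?v ?w] => rewrite (G0 (erefl false : net_adj Bbar v w = false))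
  end; rewrite ?addr0 ?add0r.

Lemma out_Vs : \sum_w G Vs w = \sum_C G Vs (VN C) + \sum_k G Vs (Vx' k).
Proof.
by sum_edges.
Qed.

Lemma out_VN C : \sum_w G (VN C) w = \sum_j G (VN C) (Vu' j).
Proof.
by sum_edges.
Qed.

Lemma in_VN C : \sum_w G w (VN C) = G Vs (VN C).
Proof.
by sum_edges.
Qed.

Lemma out_Vx' k :
  \sum_w G (Vx' k) w = \sum_r G (Vx' k) (Vx r) + \sum_j G (Vx' k) (Vu j).
Proof.
by sum_edges.
Qed.

Lemma in_Vx' k : \sum_w G w (Vx' k) = G Vs (Vx' k).
Proof.
by sum_edges.
Qed.

Lemma out_Vx r : \sum_w G (Vx r) w = G (Vx r) Vt.
Proof.
by sum_edges.
Qed.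

Lemma in_Vx r : \sum_w G w (Vx r) = \sum_k G (Vx' k) (Vx r).
Proof.
by sum_edges.
Qed.

Lemma out_Vu j : \sum_w G (Vu j) w = G (Vu j) (Vu' j).
Proof.
sum_edges.
by rewrite (bigD1 j) //= big1 ?addr0 // => i /negPf ij; apply: G0; rewrite /= eq_sym.
Qed.

Lemma in_Vu j : \sum_w G w (Vu j) = \sum_k G (Vx' k) (Vu j).
Proof.
by sum_edges.
Qed.

Lemma out_Vu' j : \sum_w G (Vu' j) w = G (Vu' j) Vt.
Proof.
by sum_edges.
Qed.

Lemma in_Vu' j :
  \sum_w G w (Vu' j) = \sum_C G (VN C) (Vu' j) + G (Vu j) (Vu' j).
Proof.
sum_edges.
by congr (_ + _); rewrite (bigD1 j) //= big1 ?addr0 // => i /negPf ij; apply: G0.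
Qed.
End Balance.

Lemma sum_le1_saturated (I : finType) (a : I -> R) :
  (forall i, a i <= 1) -> #|I|%:R <= \sum_i a i -> forall i, a i = 1.
Proof.
move=> a1 sa i; have s0 : \sum_i (1 - a i) = 0.
  apply/eqP; rewrite eq_le sumr_ge0 ?andbT => [|j _]; last by rewrite subr_ge0.
  by rewrite big_split sumrN /= sumr_const -[X in X - _]/(#|I|%:R) subr_le0.
have ge0 j : true -> 0 <= 1 - a j by rewrite subr_ge0.
by apply/esym/eqP; rewrite -subr_eq0 (psumr_eq0P ge0 s0).
Qed.

Lemma card_ntl : #|{: {S : {set 'I_n} | S \in ntl_sccs Abar}}| = num_ntl_sccs Abar.
Proof. by rewrite card_sig; apply: eq_card => S; rewrite inE. Qed.

Section FromFlow.
Variable f : net_edge Abar Bbar -> R.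
Hypothesis ff : feasible_flow f.
Hypothesis fval : (num_ntl_sccs Abar + n)%:R <= flow_value f.
Local Notation G := (flow_on f).

Let G0 v w : net_adj Bbar v w = false -> G v w = 0.
Proof. exact: flow_on_nadj. Qed.

Lemma flow_on_ge0 v w : 0 <= G v w.
Proof. by rewrite /flow_on; case: insubP => [e _ _|] //=; case: ff. Qed.

Lemma flow_on_le1 v w : w != Vt -> G v w <= 1.
Proof.
rewrite /flow_on; case: insubP => [e _ eE|] //= wt; case: ff => _ /(_ e) + _.
move=> le; apply: le_trans le _; rewrite /capacity eE.
by case: v {eE} => [||?|?|?|?|?] //; case: w wt.
Qed.

Lemma flow_on_Vx_le1 r : G (Vx r) Vt <= 1.
Proof.
rewrite /flow_on; case: insubP => [e _ eE|] //=; case: ff => _ /(_ e) + _.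
by rewrite /capacity eE.
Qed.

Lemma flow_balance v : v != Vs -> v != Vt -> \sum_w G v w = \sum_w G w v.
Proof. by move=> vs vt; rewrite -outflowE -inflowE; case: ff => _ _; apply. Qed.

(** The value of the flow is a sum of [q + n] numbers that are at most 1. *)
Lemma source_saturated :
  (forall C, G Vs (VN C) = 1) /\ (forall k, G Vs (Vx' k) = 1).
Proof.
have := fval; rewrite /flow_value outflowE (out_Vs G0) natrD -card_ntl.
rewrite -[X in _ + X%:R]card_ord => h.
have leN C : G Vs (VN C) <= 1 by apply: flow_on_le1.
have lex k : G Vs (Vx' k) <= 1 by apply: flow_on_le1.
have sN : \sum_C G Vs (VN C) <= #|{: {S : {set 'I_n} | S \in ntl_sccs Abar}}|%:R.
  by rewrite -sumr_const; apply: ler_sum.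
have sx : \sum_k G Vs (Vx' k) <= #|'I_n|%:R by rewrite -sumr_const; apply: ler_sum.
split; apply: sum_le1_saturated => //; [move: sx|move: sN]; move: h; lra.
Qed.

(** The unit of flow that enters the vertex of the component has to go to some
    input. *)
Lemma accessible_of_flow : accessible Abar Bbar.
Proof.
move=> N ntlN; pose C : {S : {set 'I_n} | S \in ntl_sccs Abar} := exist _ N ntlN.
apply: contrapT => H; have [sat _] := source_saturated.
have := @flow_balance (VN C) isT isT; rewrite (out_VN G0) (in_VN G0) sat.
rewrite big1 => [/esym/eqP|j _]; first by rewrite oner_eq0.
apply: G0; apply/negbTE/negP; rewrite /net_adj => /fintype.exists_inP[x xN Bxj].
by apply: H; exists x, j.
Qed.

Definition column_vertex (y : 'I_(n + m)) : V :=
  match split y with inl r => Vx r | inr j => Vu j end.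

Lemma column_inflow_le1 y : \sum_k G (Vx' k) (column_vertex y) <= 1.
Proof.
rewrite /column_vertex; case: split => [r|j].
  by rewrite -(in_Vx G0) -flow_balance // (out_Vx G0) flow_on_Vx_le1.
by rewrite -(in_Vu G0) -flow_balance // (out_Vu G0) flow_on_le1.
Qed.

Lemma row_outflow k : \sum_y G (Vx' k) (column_vertex y) = 1.
Proof.
have [_ sat] := source_saturated; rewrite -(sat k) -(in_Vx' G0) -flow_balance //.
rewrite (out_Vx' G0) big_split_ord /=; congr (_ + _); apply: eq_bigr => i _.
  by rewrite /column_vertex (unsplitK (inl i)).
by rewrite /column_vertex (unsplitK (inr i)).
Qed.

(** Double counting of the flow between the rows in [S] and their columns: each row
    sends out one unit and each column receives at most one. *)
Lemma hall_of_flow : hall_rows (row_mx Abar Bbar).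
Proof.
move=> S; rewrite -(ler_nat R); set NS := [set y | _].
have -> : #|S|%:R = \sum_(k in S) \sum_(y in NS) G (Vx' k) (column_vertex y).
  rewrite -sumr_const; apply: eq_bigr => k kS; rewrite -(row_outflow k).
  rewrite [RHS]big_mkcond; apply: eq_bigr => y _; case: ifP => // /negbT yNS.
  apply: G0; rewrite /column_vertex; apply/negP => adj; case/negP: yNS.
  rewrite inE; apply/existsP; exists k; rewrite kS; move: adj.
  by case: (split_ordP y) => i -> /=; rewrite ?row_mxEl ?row_mxEr
    ?(unsplitK (inl i)) ?(unsplitK (inr i)).
rewrite exchange_big -sumr_const; apply: ler_sum => y _.
apply: le_trans (column_inflow_le1 y); rewrite big_mkcond; apply: ler_sum => k _.
by case: ifP => // _; apply: flow_on_ge0.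
Qed.
End FromFlow.

Section ToFlow.
Variables (phi : 'I_n -> 'I_(n + m)) (inj_phi : injective phi).
Hypothesis phiM : forall k, row_mx Abar Bbar k (phi k).
Variable c : {S : {set 'I_n} | S \in ntl_sccs Abar} -> 'I_m.
Hypothesis cB : forall C : {S : {set 'I_n} | S \in ntl_sccs Abar},
  [exists r in val C, Bbar r (c C)].

Definition col_load (y : 'I_(n + m)) : R := \sum_k (phi k == y)%:R.
Definition comp_load (j : 'I_m) : R := \sum_C (j == c C)%:R.

Lemma col_load_ge0 y : 0 <= col_load y.
Proof. by apply: sumr_ge0 => k _; rewrite ler0n. Qed.

Lemma comp_load_ge0 j : 0 <= comp_load j.
Proof. by apply: sumr_ge0 => k _; rewrite ler0n. Qed.

Lemma col_load_le1 y : col_load y <= 1.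
Proof.
rewrite /col_load; case: (pickP (fun k => phi k == y)) => [k /eqP <-|no].
  rewrite (bigD1 k) //= eqxx big1 ?addr0 // => i ik.
  by rewrite (inj_eq inj_phi) (negPf ik).
by rewrite big1 ?ler01 // => k _; rewrite no.
Qed.

Lemma comp_load_le j : comp_load j <= n%:R.
Proof.
apply: (@le_trans _ _ (num_ntl_sccs Abar)%:R); last by rewrite ler_nat num_ntl_le.
rewrite -card_ntl -sumr_const; apply: ler_sum => C _.
by rewrite lern1 leq_b1.
Qed.

(** Each row sends its unit to the column matched to it, each component to the
    input [c] selected for it; the other values are forced by conservation. *)
Definition match_flow (v w : V) : R :=
  match v, w with
  | Vs, VN _ => 1
  | Vs, Vx' _ => 1
  | VN C, Vu' j => (j == c C)%:R
  | Vx' k, Vx r => (phi k == lshift m r)%:R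
  | Vx' k, Vu j => (phi k == rshift n j)%:R
  | Vx r, Vt => col_load (lshift m r)
  | Vu i, Vu' j => if i == j then col_load (rshift n i) else 0
  | Vu' j, Vt => comp_load j + col_load (rshift n j)
  | _, _ => 0
  end.

Lemma match_flow0 v w : net_adj Bbar v w = false -> match_flow v w = 0.
Proof.
case: v => [||C|k|r|j|j]; case: w => [||C'|k'|r'|j'|j'] //.
- by move=> nB; rewrite /=; case: eqP => // jc; move: nB; rewrite jc /net_adj cB.
- move=> nA; rewrite /=; case: eqP => // E; have := phiM k.
  by rewrite E row_mxEl; move: nA => /= ->.
- move=> nB; rewrite /=; case: eqP => // E; have := phiM k.
  by rewrite E row_mxEr; move: nB => /= ->.
- by move=> /= ->.
Qed.

Definition match_flow_edge (e : net_edge Abar Bbar) : R :=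
  match_flow (val e).1 (val e).2.

Lemma flow_on_match v w : flow_on match_flow_edge v w = match_flow v w.
Proof.
rewrite /flow_on; case: insubP => [e _ eE|/negbTE/match_flow0 ->] //=.
by rewrite /match_flow_edge eE.
Qed.

Lemma match_flow_feasible : feasible_flow match_flow_edge.
Proof.
split.
- move=> e; rewrite /match_flow_edge; case: (val e) => v w /=.
  by case: v => [||C|k|r|j|j]; case: w => [||C'|k'|r'|j'|j'] //=; rewrite ?ler0n ?ler01
    ?addr_ge0 ?col_load_ge0 ?comp_load_ge0 //; case: ifP; rewrite ?col_load_ge0.
- move=> e; rewrite /match_flow_edge /capacity; case: (val e) => v w /=.
  case: v => [||C|k|r|j|j]; case: w => [||C'|k'|r'|j'|j'] //=;
    rewrite ?ler01 ?ler0n ?lern1 ?leq_b1 ?col_load_le1 //.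
    by case: ifP; rewrite ?col_load_le1 ?ler01.
  by rewrite -[n.+1]addn1 natrD lerD ?comp_load_le ?col_load_le1.
move=> v; rewrite outflowE inflowE.
under eq_bigr do rewrite flow_on_match.
under [in RHS]eq_bigr do rewrite flow_on_match.
have M0 := match_flow0.
case: v => [||C|k|r|j|j] // _ _.
- rewrite (out_VN M0) (in_VN M0) /= (bigD1 (c C)) //= eqxx big1 ?addr0 // => j /negPf.
  by move=> ->.
- rewrite (out_Vx' M0) (in_Vx' M0) /=.
  transitivity (\sum_y (phi k == y)%:R : R); first by rewrite big_split_ord.
  by rewrite (bigD1 (phi k)) //= eqxx big1 ?addr0 // => y; rewrite eq_sym => /negPf ->.
- by rewrite (out_Vx M0) (in_Vx M0).
- by rewrite (out_Vu M0) (in_Vu M0) /= eqxx.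
- by rewrite (out_Vu' M0) (in_Vu' M0) /= eqxx.
Qed.

Lemma match_flow_value : flow_value match_flow_edge = (num_ntl_sccs Abar + n)%:R.
Proof.
rewrite /flow_value outflowE; under eq_bigr do rewrite flow_on_match.
rewrite (out_Vs match_flow0) /= !sumr_const.
by rewrite natrD -card_ntl -[X in _ = _ + X%:R]card_ord.
Qed.
End ToFlow.

Lemma flow_of_matching :
  accessible Abar Bbar ->
  (exists2 phi : 'I_n -> 'I_(n + m), injective phi &
     forall k, row_mx Abar Bbar k (phi k)) ->
  exists2 f : net_edge Abar Bbar -> R, feasible_flow f &
    flow_value f = (num_ntl_sccs Abar + n)%:R.
Proof.
move=> acc [phi inj_phi phiM].
have /choice[c cB] : forall C : {S : {set 'I_n} | S \in ntl_sccs Abar},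
    exists j, [exists r in val C, Bbar r j].
  move=> C; have [x [j [xC Bxj]]] := acc _ (valP C).
  by exists j; apply/exists_inP; exists x.
exists (match_flow_edge phi c); first exact: match_flow_feasible.
exact: match_flow_value.
Qed.
End NetworkFlows.


Theorem mainTheorem1 (R : realType) (n m : nat)
    (Abar : 'M[bool]_n) (Bbar : 'M[bool]_(n, m))
    (fstar : net_edge Abar Bbar -> R) (hmax : maximum_flow fstar) :
  structurally_controllable R Abar Bbar <->
  (num_ntl_sccs Abar + n)%:R <= flow_value fstar.
Proof.
case: hmax => ffeas fmax; split=> [sc|fval].
  have [g fg <-] := flow_of_matching R (controllable_accessible sc) (controllable_matching sc).
  exact: fmax.
exact: structural_sufficiency (accessible_of_flow ffeas fval) (hall_of_flow ffeas fval).
Qed.
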